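(* Let $X$ and $Y$ be Hausdorff spaces that are homotopy equivalent, $X\simeq Y$. Then $X$ and $Y$ have the same compact Hausdorff shape: $\mathrm{Sh}_{\mathrm{CH}}(X)=\mathrm{Sh}_{\mathrm{CH}}(Y)$.
   Context: Maps are continuous; $[\varphi]$ denotes the homotopy class of a map $\varphi$. HCpt is the category whose objects are compact Hausdorff spaces and whose morphisms are homotopy classes of maps. Direct systems. A directed set is a preordered set in which any two elements have an upper bound. A direct system in a category $\mathscr C$ is $X^*=\{X_a,p_{aa'},A\}$ with $A$ a directed set, objects $X_a$ ($a\in A$), and morphisms $p_{aa'}:X_a\to X_{a'}$ for $a\le a'$, with $p_{aa}=1_{X_a}$ and $X_a\to X_{a'}\to X_{a''}$ composing to $p_{aa''}$ for $a\le a'\le a''$. A morphism $F=(f_a,f):X^*\to Y^*=\{Y_b,q_{bb'},B\}$ consists of an order-preserving function $f:A\to B$ and morphisms $f_a:X_a\to Y_{f(a)}$ with $q_{f(a)f(a')}\circ f_a=f_{a'}\circ p_{aa'}$ for $a\le a'$. Composition is $(g_b,g)\circ(f_a,f)=(g_{f(a)}\circ f_a,\,g\circ f)$, and $1_{X^*}=(1_{X_a},1_A)$. Two morphisms $(f_a,f),(g_a,g):X^*\to Y^*$ are equivalent, written $\simeq$ when $\mathscr C=$ HCpt, if for each $a\in A$ there is $b\in B$ with $f(a)\le b$, $g(a)\le b$ and $q_{f(a)b}\circ f_a=q_{g(a)b}\circ g_a$. CH-shape. For a Hausdorff space $X$, let $c(X)$ be the set of all compact subsets of $X$ ordered by inclusion,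 and let $C(X)=\{K,[i_{KK'}],c(X)\}$ be the direct system in HCpt where $i_{KK'}:K\to K'$ is the inclusion for $K\subset K'$. Hausdorff spaces $X$ and $Y$ have the same compact Hausdorff shape, $\mathrm{Sh}_{\mathrm{CH}}(X)=\mathrm{Sh}_{\mathrm{CH}}(Y)$, if there are morphisms of direct systems in HCpt $F:C(X)\to C(Y)$ and $G:C(Y)\to C(X)$ with $GF\simeq 1_{C(X)}$ and $FG\simeq 1_{C(Y)}$. *)

(* Defs.v *)
From HB Require Import structures.
From mathcomp Require Import all_boot all_order all_algebra generic_quotient.
From mathcomp Require Import all_classical all_reals topology normedtype.
From mathcomp Require Import lra.

Set Implicit Arguments.
Unset Strict Implicit.
Unset Printing Implicit Defensive.

Import Order.TTheory GRing.Theory Num.Theory.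
Import numFieldNormedType.Exports.

Local Open Scope classical_set_scope.
Local Open Scope ring_scope.
Local Open Scope quotient_scope.

Record category := Category {
  obj :> Type;
  hom : obj -> obj -> Type;
  idm : forall a, hom a a;
  compm : forall a b c, hom b c -> hom a b -> hom a c;
  comp1m : forall a b (f : hom a b), compm (idm b) f = f;
  compm1 : forall a b (f : hom a b), compm f (idm a) = f;
  compmA : forall a b c d (h : hom c d) (g : hom b c) (f : hom a b),
    compm h (compm g f) = compm (compm h g) f }.

Arguments idm {_} _.
Arguments compm {_ _ _ _} _ _.

Declare Scope cat_scope.
Delimit Scope cat_scope with cat.
Notation "g \o f" := (compm g f) : cat_scope.

(* The index set is only required to be directed, not to be nonempty. *)
Record direct_system (C : category) := DirectSystem {
  ds_disp : Order.disp_t;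
  ds_index : preorderType ds_disp;
  ds_directed : forall a a' : ds_index,
    exists b : ds_index, (a <= b)%O /\ (a' <= b)%O;
  ds_obj :> ds_index -> C;
  ds_map : forall a a' : ds_index, (a <= a')%O -> hom (ds_obj a) (ds_obj a');
  ds_map1 : forall (a : ds_index) (aa : (a <= a)%O),
    ds_map aa = idm (ds_obj a);
  ds_mapM : forall (a a' a'' : ds_index)
      (l : (a <= a')%O) (l' : (a' <= a'')%O) (l'' : (a <= a'')%O),
    (ds_map l' \o ds_map l)%cat = ds_map l'' }.

Arguments ds_map {C} d {a a'} _.

Record ds_morphism (C : category) (X Y : direct_system C) := DSMorphism {
  dsm_index : ds_index X -> ds_index Y;
  dsm_homo : forall a a' : ds_index X,
    (a <= a')%O -> (dsm_index a <= dsm_index a')%O;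
  dsm_map : forall a : ds_index X, hom (X a) (Y (dsm_index a));
  dsm_natural : forall (a a' : ds_index X) (l : (a <= a')%O),
    (ds_map Y (dsm_homo l) \o dsm_map a)%cat =
    (dsm_map a' \o ds_map X l)%cat }.

Section ds_category.
Context {C : category}.

Program Definition ds_id (X : direct_system C) : ds_morphism X X :=
  {| dsm_index a := a; dsm_homo a a' l := l; dsm_map a := idm (X a) |}.
Next Obligation. by move=> X a a' l; rewrite compm1 comp1m. Qed.

Program Definition ds_comp (X Y Z : direct_system C)
    (G : ds_morphism Y Z) (F : ds_morphism X Y) : ds_morphism X Z :=
  {| dsm_index a := dsm_index G (dsm_index F a);
     dsm_homo a a' l := dsm_homo G (dsm_homo F l);
     dsm_map a := (dsm_map G (dsm_index F a) \o dsm_map F a)%cat |}.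
Next Obligation.
by move=> X Y Z G F a a' l; rewrite compmA dsm_natural -!compmA dsm_natural.
Qed.

Definition ds_equiv (X Y : direct_system C) (F G : ds_morphism X Y) : Prop :=
  forall a : ds_index X, exists (b : ds_index Y)
      (lF : (dsm_index F a <= b)%O) (lG : (dsm_index G a <= b)%O),
    (ds_map Y lF \o dsm_map F a)%cat = (ds_map Y lG \o dsm_map G a)%cat.

End ds_category.

Section homotopy.
Context (R : realType).

(* A homotopy is a function [X * R -> Y] of which only the restriction to the
   cylinder [X * [0, 1]] matters. *)
Definition homotopic (X Y : topologicalType) (f g : X -> Y) : Prop :=
  exists H : X * R -> Y,
    [/\ {within [set: X] `*` `[0, 1], continuous H},
        forall x, H (x, 0) = f x & forall x, H (x, 1) = g x].

Definition homotopy_equivalent (X Y : topologicalType) : Prop :=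
  exists (f : continuousType X Y) (g : continuousType Y X),
    homotopic (g \o f) idfun /\ homotopic (f \o g) idfun.

Lemma within_comp (U V W : topologicalType) (A : set U) (B : set V)
    (f : U -> V) (g : V -> W) :
  (forall x, A x -> B (f x)) -> continuous f -> {within B, continuous g} ->
  {within A, continuous (g \o f)}.
Proof.
move=> AB cf /subspace_continuousP cg; apply/subspace_continuousP => x Ax.
move=> P nP; have gP : within B (nbhs (f x)) (g @^-1` P).
  exact: cg (AB _ Ax) P nP.
suff : nbhs x [set z | A z -> P (g (f z))] by [].
by apply: (@filterS _ (nbhs x) _ _ _ _ (cf x _ gP)) => z /= Pz Az; exact/Pz/AB.
Qed.

Lemma continuous_pair (U V W : topologicalType) (f : U -> V) (g : U -> W) :
  continuous f -> continuous g -> continuous (fun x => (f x, g x)).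
Proof. by move=> cf cg x; apply: (cvg_pair (cf x) (cg x)). Qed.

Lemma fst_continuous (U V : topologicalType) : continuous (@fst U V).
Proof. by move=> x; exact: cvg_fst. Qed.

Lemma snd_continuous (U V : topologicalType) : continuous (@snd U V).
Proof. by move=> x; exact: cvg_snd. Qed.

Lemma homotopic_refl (X Y : topologicalType) (f : X -> Y) :
  continuous f -> homotopic f f.
Proof.
move=> cf; exists (f \o fst); split => //.
apply: continuous_subspaceT => x.
by apply: continuous_comp; [exact: cvg_fst|exact: cf].
Qed.

Lemma homotopic_sym (X Y : topologicalType) (f g : X -> Y) :
  homotopic f g -> homotopic g f.
Proof.
move=> [H [cH H0 H1]]; exists (H \o (fun p => (p.1, 1 - p.2))); split.
- apply: within_comp cH => [[x t] /= [_]|].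
    by rewrite !in_itv/= => tI; split => //; lra.
  apply: continuous_pair; first exact: fst_continuous.
  by move=> p; apply: cvgB; [exact: cvg_cst|exact: snd_continuous].
- by move=> x /=; rewrite subr0.
- by move=> x /=; rewrite subrr.
Qed.

Lemma homotopic_trans (X Y : topologicalType) (f g h : X -> Y) :
  homotopic f g -> homotopic g h -> homotopic f h.
Proof.
move=> [H [cH H0 H1]] [K [cK K0 K1]].
pose L (p : X * R) :=
  if p.2 <= 2^-1 then H (p.1, 2 * p.2) else K (p.1, 2 * p.2 - 1).
have cD : continuous (fun p : X * R => (p.1, 2 * p.2)).
  apply: continuous_pair; first exact: fst_continuous.
  by move=> p; apply: cvgM; [exact: cvg_cst|exact: snd_continuous].
have cE : continuous (fun p : X * R => (p.1, 2 * p.2 - 1)).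
  apply: continuous_pair; first exact: fst_continuous.
  move=> p; apply: cvgB; last exact: cvg_cst.
  by apply: cvgM; [exact: cvg_cst|exact: snd_continuous].
have clI (a b : R) : closed ([set: X] `*` `[a, b]).
  rewrite (_ : _ `*` _ = snd @^-1` `[a, b]); last first.
    by apply/seteqP; split=> [[x t] []|[x t]] //=.
  apply: preimage_closed; last exact: itv_closed.
  by move=> p _; exact: snd_continuous.
exists L; split.
- rewrite (_ : _ `*` _ =
    ([set: X] `*` `[0, 2^-1]) `|` ([set: X] `*` `[2^-1, 1])); last first.
    apply/seteqP; split=> [[x t] /= [_]|[x t] /= [][_]]; rewrite !in_itv/=.
    - by case: (leP t 2^-1) => tl tI; [left|right]; split => //; lra.
    - by move=> tI; split => //; lra.
    - by move=> tI; split => //; lra.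
  apply: withinU_continuous => //.
  + apply: (@subspace_eq_continuous _ _ _
      (H \o (fun p : X * R => (p.1, 2 * p.2)))).
      move=> [x t] /set_mem/= [_]; rewrite in_itv/= => /andP[_ tl].
      by rewrite /from_subspace /L /= tl.
    apply: within_comp cH => // -[x t] /= [_]; rewrite !in_itv/= => tI.
    by split => //; lra.
  + apply: (@subspace_eq_continuous _ _ _
      (K \o (fun p : X * R => (p.1, 2 * p.2 - 1)))).
      move=> [x t] /set_mem/= [_]; rewrite in_itv/= => /andP[tg _].
      rewrite /from_subspace /L /=; case: ifPn => // tl.
      have -> : t = 2^-1 by lra.
      have -> : 2 * 2^-1 = 1 :> R by lra.
      by rewrite subrr H1 K0.
    apply: within_comp cK => // -[x t] /= [_]; rewrite !in_itv/= => tI.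
    by split => //; lra.
- by move=> x; rewrite /L /= mulr0 ifT//; lra.
- move=> x; rewrite /L /= ifF; last by apply/negbTE; lra.
  by rewrite mulr1 (_ : 2 - 1 = 1) //; lra.
Qed.

Lemma homotopic_comp (X Y Z : topologicalType) (f f' : continuousType X Y)
    (g g' : continuousType Y Z) :
  homotopic f f' -> homotopic g g' -> homotopic (g \o f) (g' \o f').
Proof.
move=> [H [cH H0 H1]] [K [cK K0 K1]].
apply: (@homotopic_trans _ _ _ (g \o f')).
  exists (g \o H); split=> [|x|x] /=; rewrite ?H0 ?H1//.
  apply: within_continuous_comp => // y _; exact: cts_fun.
exists (K \o (fun p => (f' p.1, p.2))); split=> [|x|x] /=; rewrite ?K0 ?K1//.
apply: within_comp cK => [[x t] /= []//|].
apply: continuous_pair; last exact: snd_continuous.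
move=> p; apply: (@continuous_comp _ _ _ fst f'); last exact: cts_fun.
exact: fst_continuous.
Qed.

Definition homotopicb (X Y : topologicalType) (f g : continuousType X Y) :=
  `[< homotopic f g >].

Lemma homotopicb_refl (X Y : topologicalType) : reflexive (@homotopicb X Y).
Proof. by move=> f; apply/asboolP/homotopic_refl; exact: cts_fun. Qed.

Lemma homotopicb_sym (X Y : topologicalType) : symmetric (@homotopicb X Y).
Proof.
by move=> f g; apply/asboolP/asboolP; exact: homotopic_sym.
Qed.

Lemma homotopicb_trans (X Y : topologicalType) : transitive (@homotopicb X Y).
Proof.
move=> g f h /asboolP fg /asboolP gh; apply/asboolP.
exact: homotopic_trans fg gh.
Qed.

Canonical homotopic_equiv (X Y : topologicalType) :=
  EquivRel (@homotopicb X Y) (@homotopicb_refl X Y) (@homotopicb_sym X Y)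
    (@homotopicb_trans X Y).

Definition homotopy_class (X Y : topologicalType) : Type :=
  {eq_quot (@homotopic_equiv X Y)}.

Definition hclass (X Y : topologicalType) (f : continuousType X Y) :
  homotopy_class X Y := \pi f.

Lemma hclass_eq (X Y : topologicalType) (f g : continuousType X Y) :
  hclass f = hclass g <-> homotopic f g.
Proof.
split=> [/eqmodP/asboolP//|fg].
by apply/eqmodP/asboolP.
Qed.

Lemma hclass_repr (X Y : topologicalType) (c : homotopy_class X Y) :
  hclass (repr c) = c.
Proof. exact: reprK. Qed.

(* Composition through representatives; [hclass_compE] below shows that it does
   not depend on them. *)
Definition hclass_comp (X Y Z : topologicalType)
    (d : homotopy_class Y Z) (c : homotopy_class X Y) : homotopy_class X Z :=
  hclass (repr d \o repr c).

Lemma hclass_compE (X Y Z : topologicalType)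
    (g : continuousType Y Z) (f : continuousType X Y) :
  hclass_comp (hclass g) (hclass f) = hclass (g \o f).
Proof.
by apply/hclass_eq/homotopic_comp; apply/hclass_eq; rewrite hclass_repr.
Qed.

End homotopy.

Record compact_hausdorff := CompactHausdorff {
  ch_space :> topologicalType;
  ch_compact : compact [set: ch_space];
  ch_hausdorff : hausdorff_space ch_space }.

Program Definition HCpt (R : realType) : category :=
  {| obj := compact_hausdorff;
     hom K L := homotopy_class R K L;
     idm K := hclass R idfun;
     compm K L M d c := hclass_comp d c |}.
Next Obligation.
move=> R K L c; rewrite -[c]hclass_repr hclass_compE.
by congr hclass; apply/continuousEP.
Qed.
Next Obligation.
move=> R K L c; rewrite -[c]hclass_repr hclass_compE.
by congr hclass; apply/continuousEP.
Qed.
Next Obligation.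
move=> R K L M N e d c.
rewrite -[e]hclass_repr -[d]hclass_repr -[c]hclass_repr !hclass_compE.
by congr hclass; apply/continuousEP.
Qed.

Definition compact_subset (X : topologicalType) : Type :=
  set_type [set K : set X | compact K].

Coercion compact_subset_set (X : topologicalType) (K : compact_subset X) :
  set X := val K.

HB.instance Definition _ (X : topologicalType) :=
  SubChoice.on (compact_subset X).
HB.instance Definition _ (X : topologicalType) :=
  [SubChoice_isSubPOrder of compact_subset X by <: with set_display].

Section compact_system.
Context {X : topologicalType}.

Lemma compact_subset_directed (K L : compact_subset X) :
  exists M : compact_subset X, (K <= M)%O /\ (L <= M)%O.
Proof.
have cKL : compact (val K `|` val L) by apply: compactU; exact: set_valP.
exists (Sub (val K `|` val L) (mem_set cKL)).
by split; rewrite leEsub SubK; apply/subsetPset => x; [left|right].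
Qed.

Lemma set_type_compact (K : set X) : compact K -> compact [set: K].
Proof.
move=> cK F FF _.
have FK : (val @ F) K.
  by apply: (@filterS _ F _ setT) => [[x Kx] _|]; [exact: set_mem|exact: filterT].
have [x [Kx clx]] := cK (val @ F) _ FK.
exists (Sub x (mem_set Kx)); split => // A B FA [_ [[V oV <-] Vx] VB].
have FA' : (val @ F) (val @` A).
  by apply: (@filterS _ F _ A) => // y Ay; exists y.
have [y [[z Az <-] Vz]] := clx _ _ FA' (open_nbhs_nbhs (conj oV Vx)).
by exists z; split => //; exact: VB.
Qed.

Lemma set_type_hausdorff (K : set X) :
  hausdorff_space X -> hausdorff_space K.
Proof.
move=> hX p q clpq; apply: val_inj; apply: hX => A B nA nB.
have cv : continuous (set_val : K -> X) by exact: initial_continuous.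
by have [z [Az Bz]] := clpq _ _ (cv p A nA) (cv q B nB); exists (val z).
Qed.

Lemma subfun_continuous (K L : set X) (KL : K `<=` L) :
  continuous (subfun KL).
Proof.
apply/continuousP => _ [V oV <-]; exists V => //.
Qed.

Definition compact_subset_space (hX : hausdorff_space X)
    (K : compact_subset X) : compact_hausdorff :=
  CompactHausdorff (set_type_compact (set_valP K))
    (set_type_hausdorff (K := K) hX).

Lemma compact_subset_le (K L : compact_subset X) :
  (K <= L)%O -> K `<=` L.
Proof. by rewrite leEsub => /subsetPset. Qed.

Definition compact_inclusion (K L : compact_subset X) (KL : (K <= L)%O) :
    continuousType K L :=
  mkcts (@subfun_continuous K L (compact_subset_le KL)).

End compact_system.

Program Definition compact_system (R : realType) (X : topologicalType)
    (hX : hausdorff_space X) : direct_system (HCpt R) :=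
  {| ds_index := compact_subset X;
     ds_directed := compact_subset_directed;
     ds_obj := compact_subset_space hX;
     ds_map K L KL := hclass R (compact_inclusion KL) |}.
Next Obligation.
move=> R X hX K KK; congr hclass; apply/continuousEP => x; exact: val_inj.
Qed.
Next Obligation.
move=> R X hX K L M KL LM KM /=; rewrite hclass_compE.
by congr hclass; apply/continuousEP => x; exact: val_inj.
Qed.

Definition same_CH_shape (R : realType) (X Y : topologicalType)
    (hX : hausdorff_space X) (hY : hausdorff_space Y) : Prop :=
  exists (F : ds_morphism (compact_system R hX) (compact_system R hY))
         (G : ds_morphism (compact_system R hY) (compact_system R hX)),
    ds_equiv (ds_comp G F) (ds_id (compact_system R hX)) /\
    ds_equiv (ds_comp F G) (ds_id (compact_system R hY)).

(* Main.v *)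
Require Import Defs.
From mathcomp Require Import all_boot all_order all_algebra.
From mathcomp Require Import all_classical all_reals topology normedtype.

(** Why homotopy equivalent spaces have the same compact Hausdorff shape.

    A map [h : X -> Y] sends a compact set [K] to the compact set [h(K)], and
    the corestrictions [K -> h(K)] of [h] form a morphism [C(X) -> C(Y)].  So
    maps [f] and [g] that are homotopy inverse to each other give [F] and [G],
    and the composites [GF] and [FG] are made of restrictions of [g \o f] and
    [f \o g].  It remains to see that homotopic maps [h], [k] restrict to
    equivalent morphisms ([homotopic_ds_equiv]).  For a compact [K] in [X], a
    homotopy [H] from [h] to [k] sweeps out the set [H(K * [0, 1])], which is
    compact, being the image of a product of compact sets.  In any compact set
    containing it, [H] itself is a homotopy between the restrictions of [h] and
    [k] to [K] ([homotopic_restriction]), and such a compact set is an index at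
    which the two morphisms agree in HCpt.

    The comparison is made for all morphisms [F] consisting of restrictions of
    a given map [h], a relation written [restricts F h].  It holds of identities
    and is stable under composition, so one comparison covers the composites
    [GF] and [FG] and the identity morphisms. *)

Set Implicit Arguments.
Unset Strict Implicit.
Unset Printing Implicit Defensive.

Import Order.TTheory GRing.Theory Num.Theory.
Import numFieldNormedType.Exports.

Local Open Scope classical_set_scope.
Local Open Scope ring_scope.

(** * Restricting maps to subspaces *)

Section corestriction.
Context {U Y : topologicalType} (L : set Y) (h : U -> Y).
Context (hL : forall x, L (h x)).

Definition corestrict (x : U) : L := SigSub (mem_set (hL x)).

Lemma corestrict_continuous : continuous h -> continuous corestrict.
Proof.
move=> /continuousP ch; apply/continuousP => _ [V oV <-].
exact: ch V oV.
Qed.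

End corestriction.

Lemma set_val_continuous (X : topologicalType) (K : set X) :
  continuous (set_val : K -> X).
Proof. exact: initial_continuous. Qed.

(** * Homotopies on compact subsets *)

Section homotopy.
Context {R : realType} {X Y : topologicalType}.

(** The retraction of the line onto the unit interval; it turns a homotopy
    controlled only on the cylinder into one controlled at all times. *)
Definition clamp (t : R) : R := Num.max 0 (Num.min 1 t).

Lemma clamp_itv (t : R) : `[0, 1]%classic (clamp t).
Proof. by rewrite /= in_itv/= /clamp le_max lexx/= ge_max ler01 ge_min lexx. Qed.

Lemma clamp_continuous : continuous clamp.
Proof.
move=> t; apply: continuous_max; first exact: cst_continuous.
by apply: continuous_min; [exact: cst_continuous|].
Qed.

Lemma clamp0 : clamp 0 = 0.
Proof. by rewrite /clamp minEle ler10 maxxx. Qed.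

Lemma clamp1 : clamp 1 = 1.
Proof. by rewrite /clamp minxx maxEle ler01. Qed.

(** The compact set [D] is the track of [K] under a homotopy from [h] to [k]:
    the homotopy never leaves it, so it serves in any subspace [M] around
    [D]. *)
Lemma homotopic_restriction (h k : X -> Y) (K : set X) :
  homotopic R h k -> compact K ->
  exists2 D : set Y, compact D & forall M : set Y, D `<=` M ->
    forall u v : K -> M,
      (forall x, val (u x) = h (val x)) -> (forall x, val (v x) = k (val x)) ->
      homotopic R u v.
Proof.
move=> [H [cH H0 H1]] cK; exists (H @` (K `*` `[0, 1])).
  apply: continuous_compact; last first.
    by apply: compact_setX => //; exact: segment_compact.
  by apply: continuous_subspaceW cH => -[x t] [].
move=> M DM u v uh vk.
have HM (p : K * R) : M (H (val p.1, clamp p.2)).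
  apply: DM; exists (val p.1, clamp p.2) => //.
  by split; [exact: set_valP|exact: clamp_itv].
exists (corestrict HM); split.
- apply: continuous_subspaceT; apply: corestrict_continuous.
  apply/continuous_subspace_setT; apply: within_comp cH => [p _|].
    by split; [|exact: clamp_itv].
  apply: continuous_pair => p.
    apply: (@continuous_comp _ _ _ fst set_val); first exact: fst_continuous.
    exact: set_val_continuous.
  apply: (@continuous_comp _ _ _ snd clamp); first exact: snd_continuous.
  exact: clamp_continuous.
- by move=> x; apply: val_inj; rewrite uh /= clamp0 H0.
- by move=> x; apply: val_inj; rewrite vk /= clamp1 H1.
Qed.

End homotopy.

(** * Morphisms of compact systems made of restrictions of a map *)

Section restricts.
Context {R : realType}.

(** A morphism is compared with the map on points because the same map
    restricts to many morphisms: the index function only has to send [K] to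
    some compact set containing its image. *)
Definition restricts (X Y : topologicalType) (hX : hausdorff_space X)
    (hY : hausdorff_space Y)
    (F : ds_morphism (compact_system R hX) (compact_system R hY))
    (h : X -> Y) : Prop :=
  forall K : compact_subset X,
    exists2 u : continuousType K (dsm_index F K : compact_subset Y),
      dsm_map F K = hclass R u & forall x, val (u x) = h (val x).

Lemma restricts_id (X : topologicalType) (hX : hausdorff_space X) :
  restricts (ds_id (compact_system R hX)) idfun.
Proof. by move=> K; exists idfun. Qed.

Lemma restricts_comp (X Y Z : topologicalType) (hX : hausdorff_space X)
    (hY : hausdorff_space Y) (hZ : hausdorff_space Z)
    (F : ds_morphism (compact_system R hX) (compact_system R hY))
    (G : ds_morphism (compact_system R hY) (compact_system R hZ))
    (f : X -> Y) (g : Y -> Z) :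
  restricts F f -> restricts G g -> restricts (ds_comp G F) (g \o f).
Proof.
move=> Ff Gg K; have [u Fu uf] := Ff K; have [v Gv vg] := Gg (dsm_index F K).
exists (v \o u) => [|x]; last by rewrite /= vg uf.
by rewrite /= Fu Gv hclass_compE.
Qed.

(** Two morphisms restricting homotopic maps need not have the same index
    function, hence the comparison in a compact set that contains both indices
    as well as the track of the homotopy. *)
Lemma homotopic_ds_equiv (X Y : topologicalType) (hX : hausdorff_space X)
    (hY : hausdorff_space Y)
    (F G : ds_morphism (compact_system R hX) (compact_system R hY))
    (h k : X -> Y) :
  restricts F h -> restricts G k -> homotopic R h k -> ds_equiv F G.
Proof.
move=> Fh Gk hk K; have [u Fu uh] := Fh K; have [v Gv vk] := Gk K.
have [D cD Dhk] := homotopic_restriction hk (set_valP K).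
have [L [FL GL]] := compact_subset_directed (dsm_index F K) (dsm_index G K).
have [M [LM DM]] := compact_subset_directed L (SigSub (mem_set cD)).
exists M, (le_trans FL LM), (le_trans GL LM).
rewrite /= Fu Gv !hclass_compE; apply/hclass_eq.
apply: Dhk => [|x|x] /=; [exact: compact_subset_le DM|exact: uh|exact: vk].
Qed.

Section image_morphism.
Context {X Y : topologicalType} (hX : hausdorff_space X).
Context (hY : hausdorff_space Y) (f : continuousType X Y).

Lemma compact_image (K : compact_subset X) : compact (f @` (K : set X)).
Proof.
apply: continuous_compact; last exact: set_valP.
by apply: continuous_subspaceT; exact: cts_fun.
Qed.

Definition image_index (K : compact_subset X) : compact_subset Y :=
  SigSub (mem_set (@compact_image K)).

Lemma image_index_homo (K L : compact_subset X) :
  (K <= L)%O -> (image_index K <= image_index L)%O.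
Proof.
by move=> /compact_subset_le KL; rewrite leEsub; exact/subsetPset/image_subset.
Qed.

Lemma image_index_in (K : compact_subset X) (x : K) :
  (image_index K : set Y) (f (val x)).
Proof. by exists (val x) => //; exact: set_valP. Qed.

Lemma image_map_continuous (K : compact_subset X) :
  continuous (corestrict (@image_index_in K)).
Proof.
apply: corestrict_continuous => x.
apply: (@continuous_comp _ _ _ set_val f); first exact: set_val_continuous.
exact: cts_fun.
Qed.

Definition image_map (K : compact_subset X) :
    continuousType K (image_index K) :=
  mkcts (@image_map_continuous K).

Program Definition image_morphism :
    ds_morphism (compact_system R hX) (compact_system R hY) :=
  {| dsm_index := image_index;
     dsm_homo := image_index_homo;
     dsm_map K := hclass R (image_map K) |}.
Next Obligation.
move=> K L KL /=; rewrite !hclass_compE; congr hclass.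
by apply/continuousEP => x; exact: val_inj.
Qed.

Lemma restricts_image : restricts image_morphism f.
Proof. by move=> K; exists (image_map K). Qed.

End image_morphism.

End restricts.

Theorem theorem4p3 (R : realType) (X Y : topologicalType)
    (hX : hausdorff_space X) (hY : hausdorff_space Y) :
  homotopy_equivalent R X Y -> same_CH_shape R hX hY.
Proof.
move=> [f [g [gf fg]]].
have Ff := restricts_image (R := R) hX hY f.
have Gg := restricts_image (R := R) hY hX g.
exists (image_morphism hX hY f), (image_morphism hY hX g); split.
- exact: homotopic_ds_equiv (restricts_comp Ff Gg) (restricts_id hX) gf.
- exact: homotopic_ds_equiv (restricts_comp Gg Ff) (restricts_id hY) fg.
Qed.
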